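(* Let $K$ be a compact subgroup of the orthogonal group $\mathrm{O}(n)$ acting naturally on $\mathbb{R}^n$, let $\{\rho_1,\dots,\rho_\ell\}$ be a set of generators of the algebra $\mathcal{P}(\mathbb{R}^n)^K$ of $K$-invariant polynomials on $\mathbb{R}^n$, and let $\varphi_\xi$ ($\xi\in\mathbb{R}^n$) be a bounded spherical function of the Gelfand pair $(K,\mathbb{R}^n)$, i.e. $$\varphi_\xi(x)=\int_K e^{i\langle x,k\cdot\xi\rangle}\,dk\qquad(x\in\mathbb{R}^n).$$ Then there exists a real analytic function $h_\xi:\mathbb{R}^\ell\to\mathbb{C}$ such that $\varphi_\xi(x)=h_\xi(\rho_1(x),\dots,\rho_\ell(x))$ for every $x\in\mathbb{R}^n$.
   Context: $\mathcal{P}(\mathbb{R}^n)^K$ is the algebra of real polynomials $p$ on $\mathbb{R}^n$ with $p(k\cdot x)=p(x)$ for all $k\in K$, $x\in\mathbb{R}^n$; it is finitely generated (Hilbert), and each $\rho_j$ is real-valued. $dk$ is the normalized Haar measure on $K$. For every compact subgroup $K\subseteq\mathrm{O}(n)$ the convolution algebra $L^1(\mathbb{R}^n)^K$ of $K$-invariant integrable functions is commutative, i.e. $(K,\mathbb{R}^n)$ (short for $(K\ltimes\mathbb{R}^n,K)$) is a Gelfand pair; its bounded spherical functions are exactly the functions $\varphi_\xi$, $\xi\in\mathbb{R}^n$, given by the integral formula above. A complex-valued function on $\mathbb{R}^\ell$ is real analytic if near each point it is the sum of a convergent power series with complex coefficients. *)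

(* Defs.v *)
From HB Require Import structures.
From mathcomp Require Import all_boot all_order all_algebra finmap complex.
From mathcomp Require Import all_classical all_reals all_analysis.
From mathcomp Require Import showcase.summability.
(* Required without Import: the notations of mpoly clash with those of
   MathComp-Analysis. *)
From mathcomp.multinomials Require mpoly.

Set Implicit Arguments.
Unset Strict Implicit.
Unset Printing Implicit Defensive.

Import Order.TTheory GRing.Theory Num.Theory.
Import numFieldNormedType.Exports.

Local Open Scope classical_set_scope.
Local Open Scope ring_scope.
Local Open Scope complex_scope.

(* Vectors of R^n are columns, so that k . x is k *m x. *)

Definition orthogonal_group (R : realType) (n : nat) : set 'M[R]_n :=
  [set k | k^T *m k = 1%:M].

Definition is_subgroup (R : realType) (n : nat) (G K : set 'M[R]_n) : Prop :=
  [/\ K `<=` G,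
      K 1%:M,
      forall k1 k2, K k1 -> K k2 -> K (k1 *m k2) &
      forall k, K k -> K (invmx k)].

Definition dotp (R : realType) (n : nat) (x y : 'cV[R]_n) : R :=
  \sum_(i < n) x i 0 * y i 0.

(* M_n(R) with its Borel sigma-algebra. *)
Definition borel_mx (R : realType) (n : nat) :=
  g_sigma_algebraType (@open 'M[R]_n).

(* A Borel probability measure on K is encoded as a Borel probability measure
   on M_n(R) that gives mass 1 to K; the translate kA is the image of A. *)
Definition normalized_haar (R : realType) (n : nat) (K : set 'M[R]_n)
    (mu : probability (borel_mx R n) R) : Prop :=
  mu K = 1%E /\
  forall (k : 'M[R]_n) (A : set (borel_mx R n)), K k -> measurable A ->
    mu [set k *m a | a in A] = mu A.

Definition cexp (R : realType) (z : R[i]) : R[i] :=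
  (expR (complex.Re z))%:C * (cos (complex.Im z) +i* sin (complex.Im z)).

Definition cintegral (d : measure_display) (T : measurableType d)
    (R : realType) (mu : {measure set T -> \bar R}) (D : set T)
    (f : T -> R[i]) : R[i] :=
  (\int[mu]_(t in D) complex.Re (f t)) +i* (\int[mu]_(t in D) complex.Im (f t)).

Definition spherical (R : realType) (n : nat) (K : set 'M[R]_n)
    (mu : probability (borel_mx R n) R) (xi x : 'cV[R]_n) : R[i] :=
  cintegral mu K (fun k : 'M[R]_n => cexp ('i%C * (dotp x (k *m xi))%:C)).

Definition peval (R : realType) (n : nat) (p : mpoly.mpoly n R)
    (x : 'cV[R]_n) : R :=
  mpoly.meval (fun i => x i 0) p.

Definition invariant_polys (R : realType) (n : nat) (K : set 'M[R]_n) :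
    set (mpoly.mpoly n R) :=
  [set p | forall (k : 'M[R]_n) (x : 'cV[R]_n), K k ->
     peval p (k *m x) = peval p x].

(* The unital subalgebra generated by rho: all the q(rho_1, ..., rho_l). *)
Definition gen_algebra (R : realType) (n l : nat)
    (rho : l.-tuple (mpoly.mpoly n R)) : set (mpoly.mpoly n R) :=
  [set mpoly.comp_mpoly rho q | q in [set: mpoly.mpoly l R]].

(* The power series is an unordered sum over multi-indices: its finite partial
   sums converge along the directed set of finite sets of multi-indices. *)
Definition real_analytic (R : realType) (l : nat) (h : 'cV[R]_l -> R[i]) :
    Prop :=
  forall a : 'cV[R]_l, exists c : {ffun 'I_l -> nat} -> R[i],
    \forall y \near nbhs a,
      partial_sum (fun m : {ffun 'I_l -> nat} =>
          c m * (\prod_(j < l) ((y : 'cV[R]_l) j 0 - a j 0) ^+ m j)%:C) @ totally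
        --> (h y : R[i]^o).

(* Main.v *)
(* Expanding the exponential, [spherical K mu xi] is the series of the
   [i^m / m! * P_m] with [P_m x = \int_K <x, k xi>^m dk], an invariant polynomial
   whose weighted coefficient norm [rnorm s P_m] grows at most like [C^m].
   Writing [P_m = q_m (rho_1, ..., rho_l)], the function [h] is the series of the
   [i^m / m! * q_m], which is entire as soon as the [q_m] can be chosen with
   [rnorm r (q_m) <= C_r^m] for every [r].

   Such [q_m] come from Groebner bases.  In R[x, y], let J be the kernel of
   [y_j |-> rho_j (x)].  For a lexicographic order eliminating x, the normal form
   modulo J of a polynomial in R[rho] lies in R[y].  Since finitely many divisors
   suffice, there are weights for which every leading monomial outweighs the tail
   of its divisor, and reduction does not increase the corresponding l^1 norm. *)

Require Import Defs.
From mathcomp Require Import all_boot all_order all_algebra complex finmap.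
From mathcomp Require Import boolp.
From mathcomp.multinomials Require mpoly.

Set Implicit Arguments.
Unset Strict Implicit.
Unset Printing Implicit Defensive.

Import Order.TTheory GRing.Theory Num.Theory.

Local Open Scope ring_scope.

(** * Lexicographic order on exponents, weighted degrees and Dickson's lemma *)

Section Monomials.
Import mpoly.
Variable N : nat.
Implicit Types a b c m u : 'X_{1..N}.

(** Smaller indices are more significant, so the variables to be eliminated come first. *)
Definition lexlt a b :=
  exists i : 'I_N, (forall j : 'I_N, (j < i)%N -> a j = b j) /\ (a i < b i)%N.

Lemma lexlt_trans a b c : lexlt a b -> lexlt b c -> lexlt a c.
Proof.
move=> [i [ei li]] [j [ej lj]]; case: (ltngtP i j) => ij.
- exists i; split=> [k ki|]; first by rewrite ei // ej // (ltn_trans ki).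
  by rewrite -ej.
- exists j; split=> [k kj|]; first by rewrite ei ?ej // (ltn_trans kj).
  by rewrite ei.
- have {ij} ij : i = j by apply: val_inj.
  rewrite -ij in ej lj.
  by exists i; split=> [k ki|]; [rewrite ei ?ej | apply: ltn_trans lj].
Qed.

Lemma lexlt_total a b : a <> b -> lexlt a b \/ lexlt b a.
Proof.
move=> nab.
have [i0 hi0] : exists i, a i != b i.
  apply/existsP; rewrite -negb_forall; apply/negP => /forallP ab.
  by apply: nab; apply/mnmP => i; apply/eqP.
have [i ni mini] := @arg_minnP _ i0 (fun i => a i != b i) val hi0.
have ei (j : 'I_N) : (j < i)%N -> a j = b j.
  by move=> ji; apply/eqP/negPn/negP => /mini; rewrite leqNgt ji.
case: (ltngtP (a i) (b i)) => [l|l|e].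
- by left; exists i.
- by right; exists i; split=> // j ji; rewrite ei.
- by rewrite e eqxx in ni.
Qed.

Lemma lexlt_add2l u a b : lexlt a b -> lexlt (u + a)%MM (u + b)%MM.
Proof.
move=> [i [ei li]]; exists i; split=> [j ji|]; rewrite !mnmDE ?ltn_add2l //.
by rewrite ei.
Qed.

(** In [lexk k] the first difference occurs at an index at least [k]. Descending induction on [k]: a
    step down at index [k] lowers a natural number, and between two such steps the descent is one
    for [lexk k.+1]. *)
Lemma lexlt_wf : well_founded lexlt.
Proof.
pose lexk k a b := exists i : 'I_N,
  [/\ (k <= i)%N, forall j : 'I_N, (j < i)%N -> a j = b j & (a i < b i)%N].
suff acck d k : (k + d = N)%N -> forall a, Acc (lexk k) a.
  move=> a; elim: (acck N 0%N (add0n N) a) => {}a _ IH.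
  by constructor=> b [i [ei li]]; apply: IH; exists i.
elim: d k => [|d IHd] k kN a.
  rewrite addn0 in kN.
  by constructor=> b [i [ki _ _]]; have := ltn_ord i; rewrite kN in ki; rewrite ltnNge ki.
have k_lt : (k < N)%N by rewrite -kN addnS ltnS leq_addr.
pose i0 := Ordinal k_lt.
have [n] := ubnP (a i0).
elim: n a => [|n IHn] a ha; first by rewrite ltn0 in ha.
have : Acc (lexk k.+1) a by apply: IHd; rewrite addSnnS.
move=> acc_a; elim: acc_a ha => {}a _ IH ha; constructor=> b [i [ki ei li]].
case: (eqVneq (i : nat) k) => [eik|nik].
  have ii0 : i = i0 by apply: val_inj.
  by apply: IHn; rewrite -ii0 (leq_trans li) // ii0 -ltnS.
have lt_ki : (k < i)%N by rewrite ltn_neqAle eq_sym nik.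
by apply: IH; [exists i | rewrite (ei i0)].
Qed.

Lemma lexlt_max (s : seq 'X_{1..N}) : s != [::] ->
  exists2 m, m \in s & forall m', m' \in s -> m' <> m -> lexlt m' m.
Proof.
elim: s => // a [|b s] IH _; first by exists a => [|m]; rewrite inE // => /eqP.
have [//|m ms mmax] := IH.
have [->|/eqP nam] := eqVneq a m.
  exists m; first by rewrite mem_head.
  by move=> m'; rewrite inE => /predU1P[->|/mmax].
have [am|ma] := lexlt_total nam.
  exists m; first by rewrite inE ms orbT.
  by move=> m'; rewrite inE => /predU1P[->|/mmax].
exists a; first by rewrite mem_head.
move=> m'; rewrite inE => /predU1P[-> //|m's] nm'.
by have [->//|/eqP n'm] := eqVneq m' m; apply: lexlt_trans ma; apply: mmax.
Qed.

Definition wdeg (w : 'I_N -> nat) m := (\sum_i w i * m i)%N.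

Lemma wdegD w a b : wdeg w (a + b)%MM = (wdeg w a + wdeg w b)%N.
Proof.
by rewrite /wdeg -big_split /=; apply: eq_bigr => i _; rewrite mnmDE mulnDr.
Qed.

Lemma wdeg_le (w : 'I_N -> nat) W m : (forall i, w i <= W)%N ->
  (wdeg w m <= W * mdeg m)%N.
Proof.
move=> wW; rewrite mdegE big_distrr /=; apply: leq_sum => i _.
by rewrite leq_mul2r wW orbT.
Qed.

Lemma mdeg_le_wdeg (w : 'I_N -> nat) m : (forall i, 0 < w i)%N ->
  (mdeg m <= wdeg w m)%N.
Proof. by move=> w0; rewrite mdegE; apply: leq_sum => i _; rewrite leq_pmull. Qed.

(* With these weights, [wdeg] reads the exponents as digits in base [D]. *)
Lemma lexlt_wdeg D a b : (forall i, a i < D)%N -> lexlt a b ->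
  (wdeg (fun i => D ^ (N - i.+1)) a < wdeg (fun i => D ^ (N - i.+1)) b)%N.
Proof.
move=> aD [i [ei li]].
have tail d k : (k + d = N)%N ->
    (\sum_(j < N | k <= j) D ^ (N - j.+1) * a j < D ^ (N - k))%N.
  elim: d k => [|d IHd] k kN.
    rewrite addn0 in kN.
    by rewrite big_pred0 => [|j]; rewrite kN ?subnn // leqNgt ltn_ord.
  have k_lt : (k < N)%N by rewrite -kN addnS ltnS leq_addr.
  have := IHd k.+1; rewrite addSnnS => /(_ kN) hd.
  rewrite (bigD1 (Ordinal k_lt)) //=.
  rewrite (eq_bigl (fun j : 'I_N => (k < j)%N)) => [|j]; last first.
    by rewrite ltn_neqAle andbC -val_eqE eq_sym.
  rewrite -(ltn_add2l (D ^ (N - k.+1) * a (Ordinal k_lt))) in hd.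
  apply: leq_trans hd _; rewrite -mulnSr subnS -[X in (_ <= _ ^ X)%N](@prednK (N - k)) ?subn_gt0 //.
  by rewrite expnSr leq_mul2l aD orbT.
rewrite /wdeg (bigID (fun j : 'I_N => (j < i)%N)) /=.
rewrite [X in (_ < X)%N](bigID (fun j : 'I_N => (j < i)%N)) /=.
rewrite (eq_bigr (fun j : 'I_N => D ^ (N - j.+1) * b j)%N) => [|j ji]; last by rewrite ei.
rewrite ltn_add2l.
under eq_bigl do rewrite -leqNgt.
under [X in (_ < X)%N]eq_bigl do rewrite -leqNgt.
rewrite (bigD1 i) //= [X in (_ < X)%N](bigD1 i) //=.
rewrite (eq_bigl (fun j : 'I_N => (i < j)%N)) => [|j]; last first.
  by rewrite ltn_neqAle andbC -val_eqE eq_sym.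
apply: leq_trans (leq_addr _ _).
have := tail (N - i.+1)%N i.+1; rewrite subnKC // => /(_ erefl) ti.
rewrite -(ltn_add2l (D ^ (N - i.+1) * a i)) in ti.
by apply: leq_trans ti _; rewrite -mulnSr leq_mul2l li orbT.
Qed.

(** Induction on the number [k] of coordinates in which domination is required. *)
Lemma dickson (P : 'X_{1..N} -> Prop) : exists s : seq 'X_{1..N},
  (forall b, b \in s -> P b) /\
  (forall a, P a -> exists2 b, b \in s & (b <= a)%MM).
Proof.
suff dk k (Q : 'X_{1..N} -> Prop) : exists s : seq 'X_{1..N},
    (forall b, b \in s -> Q b) /\ (forall a, Q a ->
      exists2 b, b \in s & forall i : 'I_N, (i < k)%N -> (b i <= a i)%N).
  have [s [sP Ps]] := dk N P; exists s; split=> // a /Ps[b bs ba].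
  by exists b => //; apply/mnm_lepP => i; apply: ba.
elim: k Q => [|k IHk] Q.
  have [[a Qa]|nQ] := pselect (exists a, Q a).
    by exists [:: a]; split=> [b|b _]; [rewrite inE => /eqP->|exists a; rewrite ?mem_head].
  by exists [::]; split=> // a Qa; exfalso; apply: nQ; exists a.
have [s [sQ Qs]] := IHk Q.
case: (ltnP k N) => [k_lt|Nk]; last first.
  exists s; split=> // a /Qs[b bs ba]; exists b => // i _.
  by apply: ba; apply: leq_trans (ltn_ord i) Nk.
pose i0 := Ordinal k_lt.
have /choice[t tP] := fun d : nat => IHk (fun a => Q a /\ a i0 = d).
(* Elements whose exponent at [i0] is at least [M] are handled by [s]; the others lie in finitely
   many slices, and [t d] handles the slice where that exponent is [d]. *)
pose M := \max_(b <- s) b i0.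
exists (s ++ flatten [seq t d | d <- iota 0 M]); split=> [b|a Qa].
  rewrite mem_cat => /orP[/sQ//|/flattenP[x /mapP[d _ ->] bd]].
  by have [/(_ _ bd)[]] := tP d.
have [Ma|aM] := leqP M (a i0).
  have [b bs ba] := Qs a Qa; exists b; first by rewrite mem_cat bs.
  move=> i; rewrite ltnS leq_eqVlt => /predU1P[ik|]; last exact: ba.
  have -> : i = i0 by apply: val_inj.
  by apply: leq_trans Ma; rewrite /M (big_rem b bs) leq_maxl.
have [_ /(_ a)[//|b bt ba]] := tP (a i0).
exists b.
  rewrite mem_cat; apply/orP; right; apply/flattenP; exists (t (a i0)) => //.
  by apply: map_f; rewrite mem_iota add0n aM.
move=> i; rewrite ltnS leq_eqVlt => /predU1P[ik|]; last exact: ba.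
have -> : i = i0 by apply: val_inj.
by have [/(_ b bt)[_ ->]] := tP (a i0).
Qed.

End Monomials.

(** * Weighted l^1 norms of the coefficients of a polynomial *)

Section WeightedNorm.
Import mpoly.
Variables (R : realFieldType) (N : nat).
Implicit Types (p q : {mpoly R[N]}) (v : 'X_{1..N} -> R).

Definition mnorm v p := \sum_(m <- msupp p) `|p@_m| * v m.

Lemma mnormE v p (s : seq 'X_{1..N}) : uniq s -> {subset msupp p <= s} ->
  mnorm v p = \sum_(m <- s) `|p@_m| * v m.
Proof.
move=> us ps; rewrite [RHS](bigID (fun m => m \in msupp p)) /=.
rewrite [X in _ + X]big1 => [|m /memN_msupp_eq0 ->]; last by rewrite normr0 mul0r.
rewrite addr0 -big_filter; apply: perm_big; apply: uniq_perm => //.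
  by rewrite filter_uniq.
by move=> m; rewrite mem_filter andb_idr // => /ps.
Qed.

Lemma mnorm_ge0 v p : (forall m, 0 <= v m) -> 0 <= mnorm v p.
Proof. by move=> v0; apply: sumr_ge0 => m _; rewrite mulr_ge0. Qed.

Lemma ler_mnorm u v p : (forall m, u m <= v m) -> mnorm u p <= mnorm v p.
Proof. by move=> uv; apply: ler_sum => m _; rewrite ler_wpM2l. Qed.

Lemma mnorm0 v : mnorm v 0 = 0.
Proof. by rewrite /mnorm -mpolyC0 msupp0 big_nil. Qed.

Lemma mnormX v m : mnorm v 'X_[m] = v m.
Proof. by rewrite /mnorm msuppX big_seq1 mcoeffX eqxx normr1 mul1r. Qed.

Lemma mnormZ v c p : mnorm v (c *: p) = `|c| * mnorm v p.
Proof.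
rewrite (@mnormE v (c *: p) (msupp p)) //; last exact: msuppZ_le.
by rewrite big_distrr /=; apply: eq_bigr => m _; rewrite mcoeffZ normrM mulrA.
Qed.

Lemma mnormD v p q : (forall m, 0 <= v m) ->
  mnorm v (p + q) <= mnorm v p + mnorm v q.
Proof.
move=> v0; pose s := undup (msupp p ++ msupp q).
have us : uniq s by rewrite undup_uniq.
rewrite !(@mnormE v _ s us); first last.
- by move=> m /msuppD_le; rewrite mem_undup.
- by move=> m mp; rewrite mem_undup mem_cat mp.
- by move=> m mp; rewrite mem_undup mem_cat mp orbT.
rewrite -big_split /=; apply: ler_sum => m _.
by rewrite mcoeffD -mulrDl ler_wpM2r // ler_normD.
Qed.

Lemma mnorm_sum v (I : Type) (r : seq I) (P : pred I) (F : I -> {mpoly R[N]}) :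
  (forall m, 0 <= v m) ->
  mnorm v (\sum_(i <- r | P i) F i) <= \sum_(i <- r | P i) mnorm v (F i).
Proof.
move=> v0; elim/big_rec2: _ => [|i y x _ IH]; first by rewrite mnorm0.
by apply: le_trans (mnormD _ _ v0) _; rewrite lerD2l.
Qed.

Lemma mnormM v p q : (forall m, 0 <= v m) -> {morph v : a b / (a + b)%MM >-> a * b} ->
  mnorm v (p * q) <= mnorm v p * mnorm v q.
Proof.
move=> v0 vD; rewrite mpolyME.
apply: le_trans (mnorm_sum _ _ _ v0) _.
rewrite big_allpairs [X in _ <= X * _]/mnorm [X in _ <= _ * X]/mnorm big_distrlr /=.
apply: ler_sum => a _; apply: ler_sum => b _.
by rewrite mnormZ mnormX vD normrM mulrACA.
Qed.

Lemma mnorm1 v : mnorm v 1 = v 0%MM.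
Proof. by rewrite -mpolyX0 mnormX. Qed.

End WeightedNorm.

(** * Normal forms modulo the kernel of a ring morphism, with control of the norm *)

Section NormalForm.
Import mpoly.
Variables (R : realFieldType) (N : nat) (S : comNzRingType).
Variable e : {rmorphism {mpoly R[N]} -> S}.
Implicit Types (f g p : {mpoly R[N]}) (m : 'X_{1..N}).

(** The exponents of the initial ideal of the kernel of [e], witnessed by monic elements. *)
Definition ker_lead m := exists f, [/\ e f = 0, f@_m = 1 &
  forall m', m' \in msupp f -> m' <> m -> lexlt m' m].

Lemma ker_lead_max f : e f = 0 -> f != 0 -> exists2 m, m \in msupp f &
  ker_lead m /\ forall m', m' \in msupp f -> m' <> m -> lexlt m' m.
Proof.
move=> ef f0; have [|m mf mmax] := @lexlt_max N (msupp f).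
  by rewrite msupp_eq0.
exists m => //; split=> //; exists ((f@_m)^-1 *: f); split.
- by rewrite -mul_mpolyC rmorphM /= ef mulr0.
- by rewrite mcoeffZ mulVf // -mcoeff_msupp.
- by move=> m' /msuppZ_le; apply: mmax.
Qed.

(** Reducedness modulo a Groebner basis of the kernel of [e]. *)
Definition standard g := forall m, ker_lead m -> g@_m = 0.

(* For large [M], the leading monomial of each of the finitely many divisors
   outweighs its tail in the norm with weights [M ^+ wdeg w], so that no
   reduction step increases this norm. *)
Lemma bounded_normal_form : exists (w : 'I_N -> nat) (M0 : R),
  [/\ forall i, (0 < w i)%N, 1 <= M0 & forall p, exists g,
    [/\ e g = e p, standard g & forall M, M0 <= M ->
      mnorm (fun m => M ^+ wdeg w m) g <= mnorm (fun m => M ^+ wdeg w m) p]].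
Proof.
have [s [sP Ps]] := dickson ker_lead.
have /choice[F FP] : forall b, exists f, ker_lead b -> [/\ e f = 0, f@_b = 1 &
    forall m', m' \in msupp f -> m' <> b -> lexlt m' b].
  move=> b; have [[f fP]|nb] := pselect (ker_lead b); first by exists f.
  by exists 0 => /nb.
(* [D] exceeds every exponent in the chosen divisors, so by [lexlt_wdeg] the base-[D] weights put
   each leading monomial strictly above its tail. *)
pose D := (\max_(b <- s) \max_(m <- msupp (F b)) \max_(i < N) m i).+1.
have DP b m i : b \in s -> m \in msupp (F b) -> (m i < D)%N.
  move=> bs mb; rewrite ltnS /D (big_rem b bs) /= (big_rem m mb) /=.
  by rewrite !leq_max (leq_bigmax i).
pose w (i : 'I_N) := (D ^ (N - i.+1))%N.
(* [M0] bounds the sum of the absolute values of the coefficients of each divisor; the summand 1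
   ensures [1 <= M0]. *)
pose M0 := 1 + \sum_(b <- s) mnorm (fun=> 1) (F b).
have M0P b : b \in s -> mnorm (fun=> 1) (F b) <= M0.
  move=> bs; rewrite /M0 (big_rem b bs) /= addrCA lerDl addr_ge0 ?ler01 //.
  by apply: sumr_ge0 => c _; apply: mnorm_ge0.
have M01 : 1 <= M0 by rewrite lerDl; apply: sumr_ge0 => c _; apply: mnorm_ge0.
exists w, M0; split=> // [i|p]; first by rewrite expn_gt0.
pose v (M : R) m := M ^+ wdeg w m.
have v0 M m : M0 <= M -> 0 <= v M m.
  by move=> MM; rewrite exprn_ge0 // (le_trans ler01) // (le_trans M01).
pose good q m := [/\ e q = e 'X_[m], standard q &
  forall M, M0 <= M -> mnorm (v M) q <= v M m].
(* By linearity it is enough to reduce monomials. This serves for [p] itself and, in the induction,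
   for the remainder of one reduction step. *)
have comb q : (forall m, m \in msupp q -> exists g, good g m) -> exists g,
    [/\ e g = e q, standard g & forall M, M0 <= M -> mnorm (v M) g <= mnorm (v M) q].
  move=> H; have /choice[G GP] : forall m, exists g, m \in msupp q -> good g m.
    move=> m; have [/H[g gm]|_] := boolP (m \in msupp q); first by exists g.
    by exists 0.
  exists (\sum_(m <- msupp q) q@_m *: G m); split.
  - rewrite [in RHS](mpolyE q) !rmorph_sum /= !big_seq; apply: eq_bigr => m mq.
    have [eG _ _] := GP m mq.
    by rewrite -!mul_mpolyC !rmorphM /= eG.
  - move=> m km; rewrite raddf_sum /= big_seq big1 // => a aq.
    by have [_ sG _] := GP a aq; rewrite mcoeffZ sG // mulr0.
  - move=> M MM; apply: le_trans (mnorm_sum _ _ _ (v0 M ^~ MM)) _.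
    rewrite [X in _ <= X]/mnorm big_seq [X in _ <= X]big_seq.
    apply: ler_sum => m mq; have [_ _ nG] := GP m mq.
    by rewrite mnormZ ler_wpM2l // nG.
apply: (comb p) => m _; elim/(well_founded_ind (@lexlt_wf N)): m => m IH.
have [km|nkm] := pselect (ker_lead m); last first.
  exists 'X_[m]; split=> // [a ka|M _]; last by rewrite mnormX.
  by rewrite mcoeffX; case: eqP => // ma; rewrite -ma in ka.
have [b bs bm] := Ps m km; have [eF Fb Fmax] := FP b (sP b bs).
(* The remainder of one reduction step: subtracting the multiple of [F b] with leading monomial
   ['X_[m]] leaves only smaller monomials. *)
pose q := \sum_(t <- msupp (F b) | t != b) (- (F b)@_t) *: 'X_[(m - b + t)%MM].
have eq_q : 'X_[m] - F b * 'X_[(m - b)%MM] = q.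
  have -> : F b * 'X_[(m - b)%MM] = 'X_[m] - q.
    rewrite {1}(mpolyE (F b)) mulr_suml (bigD1_seq b) ?msupp_uniq //=; last first.
      by rewrite mcoeff_msupp Fb oner_eq0.
    rewrite Fb scale1r -mpolyXD addmC submK //; congr (_ + _).
    rewrite /q -sumrN; apply: eq_bigr => t _.
    by rewrite scaleNr opprK -scalerAl -mpolyXD addmC.
  by rewrite opprB addrC subrK.
have [|g [eg sg ng]] := comb q.
  move=> a /msupp_sum_le /flatten_mapP[t]; rewrite mem_filter => /andP[tb ts].
  move=> /msuppZ_le; rewrite msuppX inE => /eqP->.
  apply: IH; rewrite -{2}(submK bm); apply: lexlt_add2l; apply: Fmax => //.
  exact/eqP.
exists g; split=> //.
  by rewrite eg -eq_q rmorphB rmorphM /= eF mul0r subr0.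
move=> M MM; apply: le_trans (ng M MM) _.
have M1 : 1 <= M by apply: le_trans MM.
have Mge0 : 0 <= M by apply: le_trans M1.
apply: le_trans (mnorm_sum _ _ _ (v0 M ^~ MM)) _.
have wb t : t \in msupp (F b) -> t != b -> (wdeg w t < wdeg w b)%N.
  move=> ts /eqP tb; apply: lexlt_wdeg; last exact: Fmax.
  by move=> i; apply: DP ts.
(* In weight 0 the divisor has no tail and the remainder is an empty sum; otherwise the predecessor
   of [wdeg w b] is a true decrement. *)
have [wb0|wb0] := posnP (wdeg w b).
  rewrite big_seq_cond big_pred0 ?v0 // => t; apply/negP => /andP[ts tb].
  by have := wb t ts tb; rewrite wb0.
(* Every tail monomial weighs at most [M ^+ (wdeg w b).-1]; the factor [M] saved absorbs the sum of
   the coefficients, which is at most [M0]. *)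
have key : \sum_(t <- msupp (F b) | t != b) mnorm (v M) (- (F b)@_t *: 'X_[(m - b + t)%MM])
    <= mnorm (fun=> 1) (F b) * (M ^+ wdeg w (m - b)%MM * M ^+ (wdeg w b).-1).
  rewrite [X in _ <= X * _]/mnorm mulr_suml big_seq_cond [X in _ <= X](bigID (fun t => t != b)) /=.
  apply: le_trans (_ : _ <= \sum_(t <- msupp (F b) | t != b)
    `|(F b)@_t| * 1 * (M ^+ wdeg w (m - b)%MM * M ^+ (wdeg w b).-1)) _.
    rewrite [X in _ <= X]big_seq_cond; apply: ler_sum => t /andP[ts tb].
    rewrite mnormZ mnormX normrN mulr1 ler_wpM2l //.
    rewrite /v wdegD exprD ler_wpM2l ?exprn_ge0 // ler_weXn2l //.
    by have := wb t ts tb; case: (wdeg w b).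
  by rewrite lerDl sumr_ge0 // => t _; rewrite !mulr_ge0 ?exprn_ge0.
apply: le_trans key _.
have -> : v M m = v M (m - b)%MM * v M b by rewrite /v -exprD -wdegD submK.
rewrite /v mulrCA ler_wpM2l ?exprn_ge0 //.
rewrite -{2}(prednK wb0) exprS ler_wpM2r ?exprn_ge0 //.
exact: le_trans (M0P b bs) MM.
Qed.
End NormalForm.

(** * Bounded lifting of elements of the subalgebra generated by [rho] *)

Section SubalgebraSection.
Import mpoly.
Variables (R : realFieldType) (n l : nat) (rho : l.-tuple {mpoly R[n]}).

Definition rnorm k (r : R) (p : {mpoly R[k]}) : R :=
  mnorm (fun m : 'X_{1..k} => r ^+ mdeg m) p.

(** R[x, y] is encoded as polynomials in [n + l] variables, the [x_i] first. *)
Let xmon (a : 'X_{1..n}) : 'X_{1..n + l} :=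
  [multinom if split i is inl j then a j else 0%N | i < n + l].
Let ymon (b : 'X_{1..l}) : 'X_{1..n + l} :=
  [multinom if split i is inr j then b j else 0%N | i < n + l].
Let ypart (m : 'X_{1..n + l}) : 'X_{1..l} := [multinom m (rshift n j) | j < l].

Let xmonl a i : xmon a (lshift l i) = a i.
Proof. by rewrite mnmE (unsplitK (inl i)). Qed.
Let xmonr a j : xmon a (rshift n j) = 0%N.
Proof. by rewrite mnmE (unsplitK (inr j)). Qed.
Let ymonl b i : ymon b (lshift l i) = 0%N.
Proof. by rewrite mnmE (unsplitK (inl i)). Qed.
Let ymonr b j : ymon b (rshift n j) = b j.
Proof. by rewrite mnmE (unsplitK (inr j)). Qed.

(** The substitution [x_i |-> 'X_i], [y_j |-> rho_j], whose kernel is the ideal J of relations. *)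
Let gens : (n + l).-tuple {mpoly R[n]} := [tuple of [tuple 'X_i | i < n] ++ rho].

Let gensX (m : 'X_{1..n + l}) : 'X_[m] \mPo gens =
  (\prod_(i < n) 'X_i ^+ m (lshift l i)) * ('X_[ypart m] \mPo rho).
Proof.
rewrite !comp_mpolyX big_split_ord /=; congr (_ * _); apply: eq_bigr => i _.
  by rewrite tnth_lshift tnth_mktuple.
by rewrite tnth_rshift mnmE.
Qed.

(* Elimination of the variables ['X_i]: the first [n] variables, ranking
   higher in the lexicographic order, do not occur in the normal form of a
   polynomial that is congruent to a polynomial in the last [l] variables. *)
Theorem subalgebra_bounded_section : exists S : R -> R, forall P : {mpoly R[n]},
  (exists q, q \mPo rho = P) ->
  exists2 q, q \mPo rho = P & forall r, 0 <= r -> rnorm r q <= rnorm (S r) P.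
Proof.
pose e : {rmorphism {mpoly R[n + l]} -> {mpoly R[n]}} := comp_mpoly gens.
have [w [M0 [w0 M01 nf]]] := bounded_normal_form e.
pose W := \max_i w i.
have wW i : (w i <= W)%N by apply: leq_bigmax.
(* [M0] makes the bound on normal forms available, [r] makes it control [rnorm r], and the largest
   weight [W] turns weighted degree back into degree. *)
exists (fun r => Num.max M0 r ^+ W) => P [q0 q0P].
(* Two preimages of [P] under [e], one in the [x_i] alone and one in the [y_j] alone. The first is
   reduced to [g]; comparison with the second shows that [g] is free of the [x_i]. *)
pose xP := \sum_(a <- msupp P) P@_a *: 'X_[xmon a] : {mpoly R[n + l]}.
pose yq := \sum_(b <- msupp q0) q0@_b *: 'X_[ymon b] : {mpoly R[n + l]}.
have exP : e xP = P.
  rewrite raddf_sum /= [in RHS](mpolyE P); apply: eq_bigr => a _.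
  rewrite comp_mpolyZ gensX comp_mpolyX [X in _ * X]big1 ?mulr1.
    rewrite [in RHS]mpolyXE_id; congr (_ *: _); by apply: eq_bigr => i _; rewrite xmonl.
  by move=> j _; rewrite mnmE xmonr.
have eyq : e yq = P.
  rewrite -q0P [in RHS]comp_mpolyEX raddf_sum; apply: eq_bigr => /= b _.
  rewrite comp_mpolyZ gensX big1 ?mul1r => [|i _]; last by rewrite ymonl.
  rewrite comp_mpolyX.
  rewrite comp_mpolyX; congr (_ *: _); apply: eq_bigr => j _.
  by rewrite mnmE ymonr.
have [g [eg sg ng]] := nf xP.
(* If some [x_i] occurred in [g], the nonzero kernel element [g - yq] would have a leading monomial
   involving some [x_j], as these variables rank highest. It is absent from [yq], hence occurs in
   [g], against [standard g]. *)
have gx0 m : m \in msupp g -> forall i, m (lshift l i) = 0%N.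
  move=> mg i; apply/eqP/negPn/negP => mi.
  have yq0 m' j : m' \in msupp yq -> m' (lshift l j) = 0%N.
    move=> /msupp_sum_le /flatten_mapP[b _ /msuppZ_le].
    by rewrite msuppX inE => /eqP->; apply: ymonl.
  have fm : (g - yq)@_m != 0.
    rewrite mcoeffB (_ : yq@_m = 0) ?subr0 -?mcoeff_msupp //.
    by apply: memN_msupp_eq0; apply: contra mi => /yq0->.
  have [||m' m'f [km' mmax]] := @ker_lead_max _ _ _ e (g - yq).
  - by rewrite rmorphB /= eg exP eyq subrr.
  - by apply: contraNneq fm => ->; rewrite mcoeff0.
  have [j m'j] : exists j, m' (lshift l j) != 0%N.
    have [<-|/eqP nm] := eqVneq m m'; first by exists i.
    have [|k [ek lk]] := mmax m _ nm; first by rewrite mcoeff_msupp.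
    case: (split_ordP k) ek lk => j -> ek lk.
      by exists j; rewrite -lt0n (leq_trans _ lk).
    by exists i; rewrite -ek // (leq_trans (ltn_ord i)) // leq_addr.
  move: m'f; rewrite mcoeff_msupp mcoeffB sg // sub0r oppr_eq0 -mcoeff_msupp.
  by move=> /yq0 - /(_ j) /eqP; apply/negP.
exists (\sum_(m <- msupp g) g@_m *: 'X_[ypart m]).
  rewrite -exP -eg [in RHS](mpolyE g) !raddf_sum /= !big_seq.
  apply: eq_bigr => m mg; rewrite !comp_mpolyZ gensX.
  by rewrite [X in X * _]big1 ?mul1r // => i _; rewrite gx0.
move=> r r0; set M := Num.max M0 r.
have MM0 : M0 <= M by rewrite le_max lexx.
have Mr : r <= M by rewrite le_max lexx orbT.
have M1 : 1 <= M by apply: le_trans MM0.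
have M_ge0 : 0 <= M by apply: le_trans Mr.
apply: le_trans (mnorm_sum _ _ _ _) _ => [m|]; first by rewrite exprn_ge0.
apply: le_trans (_ : _ <= mnorm (fun m => M ^+ wdeg w m) g) _.
  rewrite [X in _ <= X]/mnorm; apply: ler_sum => m _.
  rewrite mnormZ mnormX ler_wpM2l //.
  apply: le_trans (_ : _ <= M ^+ mdeg (ypart m)) _.
    by apply: lerXn2r; rewrite ?nnegrE.
  rewrite ler_weXn2l //; apply: leq_trans (mdeg_le_wdeg _ w0).
  rewrite !mdegE big_split_ord /=; apply: leq_trans (leq_addl _ _).
  by apply: leq_sum => j _; rewrite mnmE.
apply: le_trans (ng M MM0) _.
apply: le_trans (mnorm_sum _ _ _ _) _ => [m|]; first by rewrite exprn_ge0.
rewrite [X in _ <= X]/rnorm [X in _ <= X]/mnorm; apply: ler_sum => a _.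
rewrite mnormZ mnormX ler_wpM2l // -exprM ler_weXn2l //.
apply: leq_trans (wdeg_le _ wW) _; rewrite leq_mul2l !mdegE big_split_ord /=.
rewrite [X in (_ + X)%N]big1 ?addn0 => [|j _]; last by rewrite xmonr.
by apply/orP; right; apply: leq_sum => i _; rewrite xmonl.
Qed.

End SubalgebraSection.

(** * Calculus of [rnorm], Taylor coefficients, and forms of degree [m] *)

Section RadiusNorm.
Import mpoly.
Variable R : realFieldType.

Lemma rnormM k r (p q : {mpoly R[k]}) : 0 <= r ->
  rnorm r (p * q) <= rnorm r p * rnorm r q.
Proof.
by move=> r0; apply: mnormM => [m|a b]; [exact: exprn_ge0 | rewrite mdegD exprD].
Qed.

Lemma rnorm_ge0 k r (p : {mpoly R[k]}) : 0 <= r -> 0 <= rnorm r p.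
Proof. by move=> r0; apply: mnorm_ge0 => m; exact: exprn_ge0. Qed.

Lemma rnorm1 k (r : R) : rnorm r (1 : {mpoly R[k]}) = 1.
Proof. by rewrite /rnorm mnorm1 mdeg0. Qed.

Lemma rnorm_prod k r (I : Type) (s : seq I) (F : I -> {mpoly R[k]}) : 0 <= r ->
  rnorm r (\prod_(i <- s) F i) <= \prod_(i <- s) rnorm r (F i).
Proof.
move=> r0; elim/big_rec2: _ => [|i y x _ IH]; first by rewrite rnorm1.
by apply: le_trans (rnormM _ _ r0) _; rewrite ler_wpM2l ?rnorm_ge0.
Qed.

Lemma rnorm_exp k r (p : {mpoly R[k]}) d : 0 <= r ->
  rnorm r (p ^+ d) <= rnorm r p ^+ d.
Proof.
move=> r0; elim: d => [|d IH]; first by rewrite !expr0 rnorm1.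
by rewrite !exprS; apply: le_trans (rnormM _ _ r0) _; rewrite ler_wpM2l ?rnorm_ge0.
Qed.

Lemma rnorm_comp k l r s (lq : l.-tuple {mpoly R[k]}) (p : {mpoly R[l]}) :
  0 <= r -> (forall j, rnorm r (tnth lq j) <= s) ->
  rnorm r (p \mPo lq) <= rnorm s p.
Proof.
move=> r0 lqs; rewrite comp_mpolyEX.
apply: le_trans (mnorm_sum _ _ _ _) _ => [m|]; first exact: exprn_ge0.
rewrite [X in _ <= X]/rnorm [X in _ <= X]/mnorm; apply: ler_sum => m _.
rewrite mnormZ ler_wpM2l // comp_mpolyX.
apply: le_trans (rnorm_prod _ _ r0) _.
rewrite mdegE -prodrXr; apply: ler_prod => j _; rewrite rnorm_ge0 //=.
apply: le_trans (rnorm_exp _ _ r0) _.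
by apply: lerXn2r (lqs j); rewrite nnegrE ?(le_trans _ (lqs j)) ?rnorm_ge0.
Qed.

Lemma rnormXU k r (i : 'I_k) : rnorm r ('X_i : {mpoly R[k]}) = r.
Proof. by rewrite /rnorm mnormX mdeg1 expr1. Qed.

Lemma rnormC k r (c : R) : rnorm r (c%:MP : {mpoly R[k]}) = `|c|.
Proof. by rewrite -[c%:MP]mulr1 mul_mpolyC /rnorm mnormZ mnorm1 mdeg0 mulr1. Qed.

(** The radius [S r] of [subalgebra_bounded_section] has no prescribed sign; this replaces it by a
    nonnegative one. *)
Lemma rnorm_normr k r (p : {mpoly R[k]}) : rnorm r p <= rnorm `|r| p.
Proof. by apply: ler_mnorm => m; rewrite -normrX ler_norm. Qed.

Definition translate l (a : 'I_l -> R) (p : {mpoly R[l]}) : {mpoly R[l]} :=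
  p \mPo [tuple 'X_j + (a j)%:MP | j < l].

Lemma rnorm_translate l (r A : R) (a : 'I_l -> R) (p : {mpoly R[l]}) : 0 <= r ->
  (forall j, `|a j| <= A) -> rnorm r (translate a p) <= rnorm (r + A) p.
Proof.
move=> r0 aA; apply: rnorm_comp => // j; rewrite tnth_mktuple.
apply: le_trans (mnormD _ _ _) _ => [m|]; first exact: exprn_ge0.
by apply: lerD; rewrite -/(rnorm _ _) ?rnormXU ?rnormC.
Qed.

(** Bridge from the multi-indices of [real_analytic] to the exponents of polynomials. *)
Definition mon_of l (f : {ffun 'I_l -> nat}) : 'X_{1..l} := [multinom f i | i < l].

Lemma mon_of_inj l : injective (@mon_of l).
Proof. by move=> f g /mnmP fg; apply/ffunP => i; have := fg i; rewrite !mnmE. Qed.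

Definition taylor_coef l (a : 'I_l -> R) (p : {mpoly R[l]}) f : R :=
  (translate a p)@_(mon_of f).

(** Each term is dominated by a term of the norm of the translate. The uniformity in [B] permits
    interchanging the sum over multi-indices with another series. *)
Lemma taylor_coef_sum_le l (r A : R) (a z : 'I_l -> R) (p : {mpoly R[l]})
    (B : seq {ffun 'I_l -> nat}) : 0 <= r -> uniq B ->
  (forall j, `|a j| <= A) -> (forall j, `|z j| <= r) ->
  \sum_(f <- B) `|taylor_coef a p f * \prod_j z j ^+ f j| <= rnorm (r + A) p.
Proof.
move=> r0 uB aA zr; apply: le_trans (rnorm_translate _ r0 aA).
set pa := translate a p; pose s := undup (msupp pa ++ map (@mon_of l) B).
have us : uniq s by rewrite undup_uniq.
rewrite /rnorm (@mnormE _ _ _ _ s us) => [|m mp]; last by rewrite mem_undup mem_cat mp.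
apply: le_trans (_ : _ <= \sum_(m <- map (@mon_of l) B) `|pa@_m| * r ^+ mdeg m) _.
  rewrite big_map; apply: ler_sum => f _; rewrite normrM ler_wpM2l // normr_prod.
  rewrite mdegE -prodrXr; apply: ler_prod => j _; rewrite normr_ge0 /= normrX mnmE.
  by apply: lerXn2r; rewrite ?nnegrE.
rewrite [X in _ <= X](bigID (fun m => m \in map (@mon_of l) B)) /=.
rewrite -[X in _ <= X + _]big_filter.
have -> : \sum_(m <- map (@mon_of l) B) `|pa@_m| * r ^+ mdeg m =
    \sum_(m <- [seq m <- s | m \in map (@mon_of l) B]) `|pa@_m| * r ^+ mdeg m.
  apply: perm_big; apply: uniq_perm; rewrite ?filter_uniq ?map_inj_uniq //.
    exact: mon_of_inj.
  by move=> m; rewrite mem_filter mem_undup mem_cat andb_idr // => ->; rewrite orbT.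
by rewrite lerDl sumr_ge0 // => m _; rewrite mulr_ge0 ?exprn_ge0.
Qed.

(** Only finitely many Taylor coefficients are nonzero, so the sum is exact once [B] contains their
    indices. *)
Lemma taylor_coef_sum l (a z : 'I_l -> R) (p : {mpoly R[l]}) :
  exists B0 : seq {ffun 'I_l -> nat}, forall B, uniq B -> {subset B0 <= B} ->
  \sum_(f <- B) taylor_coef a p f * \prod_j z j ^+ f j = p.@[fun j => z j + a j].
Proof.
pose ffun_of (m : 'X_{1..l}) : {ffun 'I_l -> nat} := [ffun i => m i].
have ffunK m : mon_of (ffun_of m) = m by apply/mnmP => i; rewrite mnmE ffunE.
exists (map ffun_of (msupp (translate a p))) => B uB sB.
have -> : p.@[fun j => z j + a j] = (translate a p).@[z].
  rewrite comp_mpoly_meval; apply: meval_eq => j.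
  by rewrite tnth_mktuple mevalD mevalXU mevalC.
rewrite [in RHS](mpolyE (translate a p)) raddf_sum /=.
rewrite (bigID (fun f => f \in map ffun_of (msupp (translate a p)))) /=.
rewrite [X in _ + X]big1 => [|f nf]; last first.
  rewrite /taylor_coef memN_msupp_eq0 ?mul0r //; apply: contra nf => fs.
  by apply/mapP; exists (mon_of f) => //; apply/mon_of_inj; rewrite ffunK.
rewrite addr0 -big_filter.
rewrite (perm_big (map ffun_of (msupp (translate a p)))) /=; last first.
  apply: uniq_perm; first by rewrite filter_uniq.
    by rewrite (map_inj_uniq (can_inj ffunK)) msupp_uniq.
  by move=> f; rewrite mem_filter andb_idr // => /sB.
rewrite big_map; apply: eq_bigr => m _; rewrite mevalZ mevalX /taylor_coef ffunK.
by congr (_ * _); apply: eq_bigr => j _; rewrite ffunE.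
Qed.

Lemma ler_norm_meval l r (z : 'I_l -> R) (p : {mpoly R[l]}) :
  (forall j, `|z j| <= r) -> `|p.@[z]| <= rnorm r p.
Proof.
move=> zr; rewrite [in X in `|X|](mpolyE p) raddf_sum /=.
apply: le_trans (ler_norm_sum _ _ _) _; apply: ler_sum => m _.
rewrite mevalZ normrM ler_wpM2l // mevalX normr_prod mdegE -prodrXr.
apply: ler_prod => j _; rewrite normr_ge0 normrX /=.
by apply: lerXn2r (zr j); rewrite nnegrE // (le_trans _ (zr j)).
Qed.

(** Monomials are indexed by words of length [m], so that powers of linear forms expand without
    multinomial coefficients. *)
Definition form_poly n m (c : {ffun 'I_m -> 'I_n} -> R) : {mpoly R[n]} :=
  \sum_f c f *: \prod_j 'X_(f j).

Lemma meval_form_poly n m (c : {ffun 'I_m -> 'I_n} -> R) (z : 'I_n -> R) :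
  (form_poly c).@[z] = \sum_f c f * \prod_j z (f j).
Proof.
rewrite raddf_sum /=; apply: eq_bigr => f _; rewrite mevalZ rmorph_prod /=.
by congr (_ * _); apply: eq_bigr => j _; rewrite mevalXU.
Qed.

Lemma rnorm_form_poly n m (c : {ffun 'I_m -> 'I_n} -> R) (B s : R) : 0 <= s ->
  (forall f, `|c f| <= B) -> rnorm s (form_poly c) <= n%:R ^+ m * B * s ^+ m.
Proof.
move=> s0 cB; apply: le_trans (mnorm_sum _ _ _ _) _ => [a|]; first exact: exprn_ge0.
apply: le_trans (_ : _ <= \sum_(f : {ffun 'I_m -> 'I_n}) B * s ^+ m) _.
  apply: ler_sum => f _; rewrite mnormZ -/(rnorm _ _).
  apply: ler_pM => //; first exact: rnorm_ge0.
  apply: le_trans (rnorm_prod _ _ s0) _.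
  under eq_bigr do rewrite rnormXU.
  by rewrite prodr_const card_ord.
by rewrite sumr_const card_ffun !card_ord -[X in X <= _]mulr_natl natrX mulrA.
Qed.

End RadiusNorm.

From mathcomp Require Import all_classical all_reals all_analysis.
From mathcomp Require Import measurable_realfun showcase.summability.

Import numFieldNormedType.Exports.

Local Open Scope classical_set_scope.

(** * Real series dominated by a convergent series *)

Section DominatedSeries.
Variable R : realType.
Implicit Types u v : R^nat.

Lemma series_dist_le u v M N : (forall k, `|u k| <= v k) -> (M <= N)%N ->
  `|series u N - series u M| <= series v N - series v M.
Proof.
move=> uv MN; rewrite !sub_series_geq //.
by apply: le_trans (ler_norm_sum _ _ _) _; apply: ler_sum.
Qed.

Lemma nondecreasing_series_le_limn v M : (forall k, 0 <= v k) ->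
  cvgn (series v) -> series v M <= limn (series v).
Proof.
move=> v0 cv; apply: nondecreasing_cvgn_le => //.
by apply: nondecreasing_series => k _ _.
Qed.

Lemma dominated_series_cvg u v : (forall k, `|u k| <= v k) ->
  cvgn (series v) -> cvgn (series u).
Proof.
move=> uv cv; apply: normed_cvg; apply: series_le_cvg cv => // k.
  exact: normr_ge0.
exact: le_trans (normr_ge0 _) (uv k).
Qed.

Lemma dominated_series_tail u v M : (forall k, `|u k| <= v k) ->
  cvgn (series v) ->
  `|limn (series u) - series u M| <= limn (series v) - series v M.
Proof.
move=> uv cv; have cu := dominated_series_cvg uv cv.
have v0 k : 0 <= v k by apply: le_trans (normr_ge0 _) (uv k).
have cuM : (fun N => `|series u N - series u M|) @ \oo -->
    `|limn (series u) - series u M|.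
  by apply: cvg_norm; apply: cvgB => //; apply: cvg_cst.
rewrite -(cvg_lim _ cuM) //; apply: limr_le; first by apply/cvg_ex; eexists; exact: cuM.
near=> N; apply: le_trans (_ : _ <= series v N - series v M) _.
  by apply: series_dist_le => //; near: N; exact: nbhs_infty_ge.
by rewrite lerD2r nondecreasing_series_le_limn.
Unshelve. all: by end_near. Qed.

Lemma series_tail_cvg0 v : cvgn (series v) ->
  (fun M => limn (series v) - series v M) @ \oo --> (0 : R).
Proof.
move=> cv; rewrite -(subrr (limn (series v))).
by apply: cvgB => //; apply: cvg_cst.
Qed.

Lemma series_cvg_by_tail u v s : cvgn (series v) ->
  (forall M, `|s - series u M| <= limn (series v) - series v M) ->
  series u @ \oo --> s.
Proof.
move=> cv us; apply/cvgrPdist_le => e e0.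
have /cvgrPdist_le /(_ e e0) := series_tail_cvg0 cv.
apply: filterS => M; rewrite sub0r normrN => He.
by apply: le_trans (us M) _; apply: le_trans (ler_norm _) _.
Qed.

End DominatedSeries.

(** * Power series expansion of an entire series of polynomials *)

Section EntireSum.
Variables (R : realType) (l : nat) (q : nat -> mpoly.mpoly l R) (alpha : R^nat).
Hypothesis alpha1 : forall k, `|alpha k| <= 1.
Hypothesis q_bound : forall r : R, 0 <= r ->
  exists2 C : R, 0 <= C & forall k, rnorm r (q k) <= C ^+ k.

(** For suitable [alpha] this is the real or imaginary part of [h]. By [q_bound] the series
    converges at every point, so [limn] is a true limit. *)
Definition entire_sum (y : 'cV[R]_l) : R :=
  limn (series (fun k => alpha k / k`!%:R * peval (q k) y)).

Let coef_le (C t : R) k : `|t| <= C ^+ k -> `|alpha k / k`!%:R * t| <= exp_coeff C k.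
Proof.
move=> tC; rewrite /exp_coeff /= mulrAC normrM normfV normr_nat ler_wpM2r //.
by rewrite normrM -(mul1r (C ^+ k)) ler_pM.
Qed.

(** Expanding each [q k] about [a] gives a double series dominated by an exponential one; summing
    over [k] first yields the coefficients. *)
Lemma entire_sum_analytic (a : 'cV[R]_l) : exists c : {ffun 'I_l -> nat} -> R,
  forall y : 'cV[R]_l,
    partial_sum (fun m : {ffun 'I_l -> nat} =>
      c m * \prod_(j < l) (y j 0 - a j 0) ^+ m j) @ totally --> entire_sum y.
Proof.
pose t k m := alpha k / k`!%:R * taylor_coef (a ^~ 0) (q k) m.
exists (fun m => limn (series (t ^~ m))) => y.
pose z j := y j 0 - a j 0.
(* The summand 1 in [r] admits the point with all coordinates 1, where a term of the Taylor sum is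
   the coefficient itself; this gives [t_cvg]. *)
pose r : R := 1 + \sum_j `|z j|; pose A : R := \sum_j `|a j 0|.
have zr j : `|z j| <= r.
  by rewrite /r (bigD1 j) //= addrCA lerDl addr_ge0 // sumr_ge0.
have aA j : `|a j 0| <= A by rewrite /A (bigD1 j) //= lerDl sumr_ge0.
have r1 : 1 <= r by rewrite lerDl sumr_ge0.
have r0 : 0 <= r by rewrite (le_trans ler01).
have A0 : 0 <= A by rewrite sumr_ge0.
have [C C0 qC] := q_bound (addr_ge0 r0 A0).
have cvC := is_cvg_series_exp_coeff C.
pose U (B : seq {ffun 'I_l -> nat}) k := \sum_(m <- B) t k m * \prod_j z j ^+ m j.
have UE B k : U B k = alpha k / k`!%:R *
    \sum_(m <- B) taylor_coef (a ^~ 0) (q k) m * \prod_j z j ^+ m j.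
  by rewrite mulr_sumr; apply: eq_bigr => m _; rewrite mulrA.
have U_le B k : uniq B -> `|U B k| <= exp_coeff C k.
  move=> uB; rewrite UE; apply: coef_le.
  apply: le_trans (ler_norm_sum _ _ _) (le_trans _ (qC k)).
  exact: taylor_coef_sum_le.
have t_cvg m : cvgn (series (t ^~ m)).
  apply: (@dominated_series_cvg _ _ (exp_coeff C)) => // k; apply: coef_le.
  have := @taylor_coef_sum_le R l r A (a ^~ 0) (fun=> 1) (q k) [:: m] r0.
  rewrite /= big_seq1 big1 ?mulr1 => [|j _]; last by rewrite expr1n.
  move=> /(_ isT aA) h; apply: le_trans (qC k); apply: h => j.
  by rewrite normr1.
have partialE (B : {fset {ffun 'I_l -> nat}}) :
    partial_sum (fun m => limn (series (t ^~ m)) * \prod_j z j ^+ m j) B =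
    limn (series (U B)).
  rewrite /partial_sum -(big_seq_fsetE _ _ predT
    (fun m => limn (series (t ^~ m)) * \prod_j z j ^+ m j)) /=.
  apply/esym/cvg_lim => //.
  have -> : series (U B) =
      fun N => \sum_(m <- B) series (t ^~ m) N * \prod_j z j ^+ m j.
    apply/funext => N; rewrite /series /= exchange_big; apply: eq_bigr => m _.
    by rewrite mulr_suml.
  apply: cvg_big => [|m _]; first exact: add_continuous.
  by apply: cvgM; [exact: t_cvg | exact: cvg_cst].
have peval_le k : `|peval (q k) y| <= C ^+ k.
  apply: le_trans (qC k); apply: ler_norm_meval => j.
  rewrite -(subrK (a j 0) (y j 0)); apply: le_trans (ler_normD _ _) _.
  by apply: lerD; [exact: zr|exact: aA].
have totallyF : Filter (@totally {ffun 'I_l -> nat}).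
  by apply: filter_filter; exact: totally_filter.
apply/(@cvgrPdist_le R R _ _ totallyF) => e e0.
have e20 : 0 < e / 2 by rewrite divr_gt0.
have /cvgrPdist_le /(_ _ e20) := series_tail_cvg0 cvC.
move=> /filter_ex[M]; rewrite sub0r normrN => tailM.
have {}tailM := le_trans (ler_norm _) tailM.
(* Once [B] contains the Taylor supports of the [q k] with [k < M], the first [M] terms of both
   series agree exactly, and each tail is at most [e / 2]. *)
have /choice[B0 B0P] := fun k => @taylor_coef_sum R l (a ^~ 0) z (q k).
pose s := flatten [seq B0 k | k <- iota 0 M].
exists (seq_fset tt s) => // B /= sB.
rewrite partialE.
have serUE : series (U B) M = series (fun k => alpha k / k`!%:R * peval (q k) y) M.
  rewrite /series /= !big_seq; apply: eq_bigr => k.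
  rewrite mem_index_iota => /andP[_ kM]; rewrite UE B0P ?fset_uniq //.
    congr (_ * _); apply: mpoly.meval_eq => j.
    by rewrite /z subrK.
  move=> m mk; apply: (fsubsetP sB).
  have -> : (m \in seq_fset tt s) = (m \in s) by rewrite seq_fsetE.
  apply/flattenP.
  by exists (B0 k) => //; apply: map_f; rewrite mem_iota.
rewrite -(subrKA (series (U B) M)) (splitr e).
apply: le_trans (ler_normD _ _) _; apply: lerD.
  rewrite serUE; apply: le_trans tailM; apply: dominated_series_tail => // k.
  exact: coef_le.
rewrite distrC; apply: le_trans tailM; apply: dominated_series_tail => // k.
by apply: U_le; exact: fset_uniq.
Qed.

End EntireSum.

(** * Continuity and Borel measurability on spaces of matrices *)

Section MatrixTopology.
Variable R : realType.

(** Makes compact sets of matrices closed, hence Borel. *)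
Lemma mx_hausdorff m n : hausdorff_space 'M[R]_(m, n).
Proof.
move=> A B clAB; apply/matrixP => i j.
apply: (@Rhausdorff R) => U V UA VB.
have [C [UC VC]] := clAB _ _ (@coord_continuous R m n i j A U UA)
  (@coord_continuous R m n i j B V VB).
by exists (C i j).
Qed.

Lemma mx_continuous (T : topologicalType) m n (f : T -> 'M[R]_(m, n)) :
  (forall i j, continuous (fun x => f x i j)) -> continuous f.
Proof.
move=> cf x A [P Pn sPA].
have : \forall y \near x, forall ij : 'I_m * 'I_n, P ij.1 ij.2 (f y ij.1 ij.2).
  by apply: filter_forall => -[i j]; exact: cf (Pn i j).
by apply: filterS => y Py; apply: sPA => i j; exact: Py (i, j).
Qed.

Lemma continuous_sumr (T : topologicalType) (I : Type) (r : seq I) (F : I -> T -> R) :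
  (forall i, continuous (F i)) -> continuous (fun x => \sum_(i <- r) F i x).
Proof.
by move=> cF x; apply: cvg_big => [|i _]; [exact: add_continuous | exact: cF].
Qed.

Lemma continuous_cst (T : topologicalType) (c : R) : continuous (fun _ : T => c).
Proof. by move=> x; apply: cvg_cst. Qed.

Lemma continuous_mulr (T : topologicalType) (f g : T -> R) :
  continuous f -> continuous g -> continuous (fun x => f x * g x).
Proof. by move=> cf cg x; apply: cvgM; [exact: cf | exact: cg]. Qed.

Lemma continuous_subr (T : topologicalType) (f g : T -> R) :
  continuous f -> continuous g -> continuous (fun x => f x - g x).
Proof. by move=> cf cg x; apply: cvgB; [exact: cf | exact: cg]. Qed.

Lemma continuous_normr (T : topologicalType) (f : T -> R) :
  continuous f -> continuous (fun x => `|f x|).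
Proof. by move=> cf x; apply: cvg_norm; exact: cf. Qed.

Lemma continuous_prodr (T : topologicalType) (I : Type) (r : seq I) (F : I -> T -> R) :
  (forall i, continuous (F i)) -> continuous (fun x => \prod_(i <- r) F i x).
Proof.
by move=> cF x; apply: cvg_big => [|i _]; [exact: mul_continuous | exact: cF].
Qed.

Lemma continuous_mulmx_entry m n p (A : 'M[R]_(m, n)) (B : 'M[R]_(n, p)) i j :
  continuous (fun M : 'M[R]_(m, n) => (M *m B) i j) /\
  continuous (fun M : 'M[R]_(n, p) => (A *m M) i j).
Proof.
split.
  under eq_fun do rewrite mxE.
  apply: continuous_sumr => s; apply: continuous_mulr; first exact: coord_continuous.
  exact: continuous_cst.
under eq_fun do rewrite mxE.
apply: continuous_sumr => s; apply: continuous_mulr; last exact: coord_continuous.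
exact: continuous_cst.
Qed.

Lemma mulmx_continuous m n p (A : 'M[R]_(m, n)) :
  continuous (fun M : 'M[R]_(n, p) => A *m M).
Proof.
by apply: mx_continuous => i j; case: (@continuous_mulmx_entry m n p A 0 i j).
Qed.

Lemma borel_mx_measurable_fun n (f : 'M[R]_n -> R) :
  continuous f -> measurable_fun [set: borel_mx R n] f.
Proof.
move=> /continuousP cf; apply: (measurability _ (RGenOpens.measurableE R)).
move=> _ [_ [a [b ->] <-]]; rewrite setTI; apply: sub_sigma_algebra.
exact/cf/interval_open.
Qed.

Lemma borel_mx_measurable_mulmx n (k : 'M[R]_n) :
  measurable_fun [set: borel_mx R n] (mulmx k : borel_mx R n -> borel_mx R n).
Proof.
apply: (@measurability _ _ (borel_mx R n) (borel_mx R n) setT _ (@open 'M[R]_n)) => //.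
move=> _ [B oB <-]; rewrite setTI; apply: sub_sigma_algebra.
have /continuousP cm := @mulmx_continuous n n n k; exact: cm.
Qed.

End MatrixTopology.

(** * Averages over [K] and their invariance under translation *)

Section HaarAverage.
Variables (R : realType) (n : nat) (K : set 'M[R]_n).
Variable mu : probability (borel_mx R n) R.
Hypothesis K_subgroup : is_subgroup (@orthogonal_group R n) K.
Hypothesis K_compact : compact K.
Hypothesis mu_haar : normalized_haar K mu.

Definition average (f : 'M[R]_n -> R) : R :=
  \int[mu]_(k in (K : set (borel_mx R n))) f k.

Let K_measurable : measurable (K : set (borel_mx R n)).
Proof.
have := compact_closed (@mx_hausdorff R n n) K_compact.
rewrite -openC => oK; rewrite -[K]setCK; apply: measurableC.
exact: sub_sigma_algebra.
Qed.

Let muK_fin : (mu (K : set (borel_mx R n)) < +oo)%E.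
Proof. by have [-> _] := mu_haar; rewrite ltry. Qed.

Lemma continuous_integrable (f : 'M[R]_n -> R) : continuous f ->
  mu.-integrable (K : set (borel_mx R n)) (EFin \o f).
Proof.
move=> cf; apply: measurable_bounded_integrable => //.
  by apply: measurable_funTS; exact: borel_mx_measurable_fun.
have /compact_bounded[M [_ mrt]] :=
  continuous_compact (@continuous_subspaceT _ _ K f cf) K_compact.
by exists M; split; rewrite ?num_real // => ? ? ? ?; exact: mrt.
Qed.

Lemma averageZ c (f : 'M[R]_n -> R) : continuous f ->
  average (fun k => c * f k) = c * average f.
Proof. by move=> cf; apply: RintegralZl => //; exact: continuous_integrable. Qed.

Lemma averageB (f g : 'M[R]_n -> R) : continuous f -> continuous g ->
  average (fun k => f k - g k) = average f - average g.
Proof. by move=> cf cg; apply: RintegralB => //; exact: continuous_integrable. Qed.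

Lemma average_cst c : average (fun=> c) = c.
Proof.
transitivity (c * fine (mu (K : set (borel_mx R n)))); first exact: Rintegral_cst.
by have [-> _] := mu_haar; rewrite /= mulr1.
Qed.

Lemma average_sum (I : Type) (r : seq I) (F : I -> 'M[R]_n -> R) :
  (forall i, continuous (F i)) ->
  average (fun k => \sum_(i <- r) F i k) = \sum_(i <- r) average (F i).
Proof.
move=> cF; elim: r => [|i r IH].
  under [in LHS]eq_fun do rewrite big_nil.
  by rewrite average_cst big_nil.
under [in LHS]eq_fun do rewrite big_cons.
rewrite big_cons -IH; apply: RintegralD => //; apply: continuous_integrable => //.
exact: continuous_sumr.
Qed.

Lemma eq_average (f g : 'M[R]_n -> R) : (forall k, K k -> f k = g k) ->
  average f = average g.
Proof. by move=> fg; apply: eq_Rintegral => k /set_mem; exact: fg. Qed.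

Lemma average_norm_le (f : 'M[R]_n -> R) B : continuous f ->
  (forall k, K k -> `|f k| <= B) -> `|average f| <= B.
Proof.
move=> cf fB; apply: le_trans (le_normr_Rintegral _ _) _ => //.
  exact: continuous_integrable.
rewrite -[leRHS]average_cst; apply: le_Rintegral => //.
- by apply: (@continuous_integrable (fun k => `|f k|)); exact: continuous_normr.
- by apply: continuous_integrable; exact: continuous_cst.
Qed.

Lemma subgroup_tr k : K k -> K k^T.
Proof.
have [Korth _ _ Kinv] := K_subgroup => Kk.
have kk : k^T *m k = 1%:M by exact: Korth.
have [_ ku] := mulmx1_unit kk.
by rewrite -[k^T]mulmx1 -(mulmxV ku) mulmxA kk mul1mx; exact: Kinv.
Qed.

Lemma subgroup_mulVK k (a : 'M[R]_n) : K k -> k *m (k^T *m a) = a.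
Proof.
have [Korth _ _ _] := K_subgroup => Kk; rewrite mulmxA.
by have := Korth _ Kk => /mulmx1C ->; rewrite mul1mx.
Qed.

(** Change of variables along [mulmx k]. The pushforward involves preimages and [normalized_haar]
    images, but the preimage under [k] is the translate by [k^T], the inverse of [k] in [K]. *)
Lemma average_mull k (f : 'M[R]_n -> R) : K k -> continuous f ->
  average (fun a => f (k *m a)) = average f.
Proof.
move=> Kk cf; have Ktk := subgroup_tr Kk.
have [_ _ KM _] := K_subgroup.
have preE (A : set 'M[R]_n) : mulmx k @^-1` A = [set k^T *m a | a in A].
  apply/seteqP; split => [b /= kbA|_ [a Aa <-] /=].
    exists (k *m b) => //; rewrite -{2}(trmxK k); exact: subgroup_mulVK.
  by rewrite subgroup_mulVK.
have preK : mulmx k @^-1` K = K.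
  apply/seteqP; split => [b /= kbK|b Kb /=]; last exact: KM.
  by rewrite -(subgroup_mulVK b Ktk) trmxK; exact: KM.
rewrite /average /Rintegral; congr fine.
have := @integral_pushforward _ _ (borel_mx R n) (borel_mx R n) R (mulmx k)
  (borel_mx_measurable_mulmx k) mu K (EFin \o f).
rewrite preK => <- //.
- apply: (eq_measure_integral mu) => [|mk A mA AK]; first exact: borel_mx_measurable_mulmx.
  have [_ muE] := mu_haar; have := muE k^T A Ktk mA.
  by rewrite -preE; apply.
- by apply/measurable_EFinP; exact: borel_mx_measurable_fun.
- apply: (@continuous_integrable (fun a => f (k *m a))) => a.
  by apply: (@continuous_comp _ _ _ (mulmx k) f); [exact: mulmx_continuous | exact: cf].
Qed.

End HaarAverage.

(** * Moments of the orbit of [xi] and their lifts through [rho] *)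

Section SphericalAverages.
Variables (R : realType) (n l : nat) (K : set 'M[R]_n).
Variable mu : probability (borel_mx R n) R.
Hypothesis K_subgroup : is_subgroup (@orthogonal_group R n) K.
Hypothesis K_compact : compact K.
Hypothesis mu_haar : normalized_haar K mu.
Variable rho : l.-tuple (mpoly.mpoly n R).
Hypothesis rho_gen : gen_algebra rho = invariant_polys K.
Variable xi : 'cV[R]_n.

Let avg := average K mu.
Let V : R := \sum_i `|xi i 0|.

(** The square of the entry is one of the nonnegative terms of a diagonal entry of [k^T *m k], which
    is 1. *)
Lemma orthogonal_entry_le1 (k : 'M[R]_n) i s : orthogonal_group k -> `|k i s| <= 1.
Proof.
move=> /matrixP /(_ s s); rewrite !mxE eqxx => kss.
rewrite -[leRHS]normr1 -ler_sqr ?nnegrE // !normr1 expr1n real_normK ?num_real //.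
rewrite -[leRHS]kss (bigD1 i) //= !mxE expr2 lerDl sumr_ge0 // => j _.
by rewrite !mxE -expr2 sqr_ge0.
Qed.

Lemma orbit_entry_le k i : K k -> `|(k *m xi) i 0| <= V.
Proof.
have [KO _ _ _] := K_subgroup => Kk; rewrite mxE.
apply: le_trans (ler_norm_sum _ _ _) _; apply: ler_sum => s _.
by rewrite normrM ler_piMl // orthogonal_entry_le1 //; exact: KO.
Qed.

Lemma dotp_orbit_le x k : K k -> `|dotp x (k *m xi)| <= \sum_i `|x i 0| * V.
Proof.
move=> Kk; apply: le_trans (ler_norm_sum _ _ _) _; apply: ler_sum => i _.
by rewrite normrM ler_wpM2l // orbit_entry_le.
Qed.

Lemma orbit_entry_continuous i : continuous (fun k : 'M[R]_n => (k *m xi) i 0).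
Proof. by case: (@continuous_mulmx_entry R n n 1 0 xi i 0). Qed.

Lemma dotp_orbit_continuous x : continuous (fun k : 'M[R]_n => dotp x (k *m xi)).
Proof.
apply: continuous_sumr => i; apply: continuous_mulr; first exact: continuous_cst.
exact: orbit_entry_continuous.
Qed.

(** The polynomial [P_m], expanded over words; its coefficients are the moments of the coordinates
    on the orbit of [xi]. *)
Definition moment_poly m : mpoly.mpoly n R :=
  form_poly (fun f : {ffun 'I_m -> 'I_n} => avg (fun k => \prod_j (k *m xi) (f j) 0)).

Let monomial_continuous m (f : {ffun 'I_m -> 'I_n}) :
  continuous (fun k : 'M[R]_n => \prod_j (k *m xi) (f j) 0).
Proof. by apply: continuous_prodr => j; exact: orbit_entry_continuous. Qed.

Lemma peval_moment_poly m x :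
  peval (moment_poly m) x = avg (fun k => dotp x (k *m xi) ^+ m).
Proof.
rewrite /peval /moment_poly meval_form_poly.
transitivity (avg (fun k => \sum_(f : {ffun 'I_m -> 'I_n})
    (\prod_j x (f j) 0) * \prod_j (k *m xi) (f j) 0)).
  rewrite /avg average_sum // => [|f]; last first.
    by apply: continuous_mulr; [exact: continuous_cst | exact: monomial_continuous].
  by apply: eq_bigr => f _; rewrite averageZ // mulrC.
apply: eq_average => k _; rewrite /dotp -[X in _ ^+ X]card_ord -prodr_const.
by rewrite bigA_distr_bigA; apply: eq_bigr => f _; rewrite big_split.
Qed.

Lemma rnorm_moment_poly s m : 0 <= s -> rnorm s (moment_poly m) <= (n%:R * V * s) ^+ m.
Proof.
move=> s0; rewrite !exprMn; apply: rnorm_form_poly => // f.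
apply: average_norm_le => // k Kk; rewrite normr_prod -[X in _ ^+ X]card_ord.
rewrite -prodr_const; apply: ler_prod => j _.
by rewrite normr_ge0 orbit_entry_le.
Qed.

(** Transposition moves [k] across the inner product, [<k x, a xi> = <x, k^T a xi>], and translation
    by [k^T] preserves averages. *)
Lemma moment_poly_invariant m : invariant_polys K (moment_poly m).
Proof.
move=> k x Kk; rewrite !peval_moment_poly.
rewrite -[RHS](average_mull K_subgroup K_compact mu_haar (subgroup_tr K_subgroup Kk)).
  apply: eq_average => a _; congr (_ ^+ m).
  have dotpE (u v : 'cV[R]_n) : dotp u v = (u^T *m v) 0 0.
    by rewrite mxE; apply: eq_bigr => i _; rewrite mxE.
  by rewrite !dotpE trmx_mul !mulmxA.
have -> : (fun a : 'M[R]_n => dotp x (a *m xi) ^+ m) =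
    (fun a => \prod_(j < m) dotp x (a *m xi)).
  by apply/funext => a; rewrite prodr_const card_ord.
by apply: continuous_prodr => j; exact: dotp_orbit_continuous.
Qed.

(** The radius [S r] does not depend on [m], so the geometric growth of the moment polynomials
    passes to their lifts. *)
Lemma moment_poly_lift : exists q : nat -> mpoly.mpoly l R,
  (forall m x, peval (q m) (\col_(j < l) peval (tnth rho j) x) =
     avg (fun k => dotp x (k *m xi) ^+ m)) /\
  forall r : R, 0 <= r -> exists2 C : R, 0 <= C & forall m, rnorm r (q m) <= C ^+ m.
Proof.
have [S SP] := subalgebra_bounded_section rho.
have /choice[q qP] : forall m, exists q : mpoly.mpoly l R,
    mpoly.comp_mpoly rho q = moment_poly m /\
    forall r, 0 <= r -> rnorm r q <= rnorm (S r) (moment_poly m).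
  move=> m; have [|q qm qr] := SP (moment_poly m); last by exists q.
  have := @moment_poly_invariant m; rewrite -rho_gen => -[q _ qm].
  by exists q.
exists q; split=> [m x|r r0].
  rewrite -peval_moment_poly; have [<- _] := qP m.
  rewrite /peval mpoly.comp_mpoly_meval; apply: mpoly.meval_eq => j.
  by rewrite mxE.
have V0 : 0 <= V by apply: sumr_ge0.
exists (n%:R * V * `|S r|); first by rewrite !mulr_ge0.
move=> m; have [_ qr] := qP m; apply: le_trans (qr r r0) _.
by apply: le_trans (rnorm_normr _ _) _; exact: rnorm_moment_poly.
Qed.

(** The common treatment of cosine and sine: average and power series are interchanged, then the
    moments are replaced by their lifts. *)
Lemma average_entire (F : R -> R) (alpha : R^nat) : continuous F ->
  (forall k, `|alpha k| <= 1) ->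
  (forall t, F t = limn (series (fun k => alpha k / k`!%:R * t ^+ k))) ->
  exists h : 'cV[R]_l -> R,
    (forall x, avg (fun k => F (dotp x (k *m xi))) = h (\col_(j < l) peval (tnth rho j) x)) /\
    forall a : 'cV[R]_l, exists c : {ffun 'I_l -> nat} -> R, forall y : 'cV[R]_l,
      partial_sum (fun m : {ffun 'I_l -> nat} =>
        c m * \prod_(j < l) (y j 0 - a j 0) ^+ m j) @ totally --> h y.
Proof.
move=> cF alpha1 FE; have [q [qE q_bound]] := moment_poly_lift.
exists (entire_sum q alpha); split; last exact: entire_sum_analytic.
move=> x; apply/esym/cvg_lim => //.
(* [T] bounds [dotp x (k *m xi)] for all [k] in [K], so the remainder of the series of [F] is at
   most the exponential tail at [T], and averaging keeps this bound. *)
pose T := \sum_i `|x i 0| * V.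
have cvT := is_cvg_series_exp_coeff T.
apply: (series_cvg_by_tail cvT) => M.
have c_pow m : continuous (fun k : 'M[R]_n => dotp x (k *m xi) ^+ m).
  have -> : (fun k : 'M[R]_n => dotp x (k *m xi) ^+ m) =
      (fun k => \prod_(j < m) dotp x (k *m xi)).
    by apply/funext => k; rewrite prodr_const card_ord.
  by apply: continuous_prodr => j; exact: dotp_orbit_continuous.
have c_term m : continuous (fun k : 'M[R]_n => alpha m / m`!%:R * dotp x (k *m xi) ^+ m).
  by apply: continuous_mulr; [exact: continuous_cst | exact: c_pow].
have cFd : continuous (fun k : 'M[R]_n => F (dotp x (k *m xi))).
  move=> k; apply: (@continuous_comp _ _ _ (fun k : 'M[R]_n => dotp x (k *m xi)) F).
    exact: dotp_orbit_continuous.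
  exact: cF.
have -> : series (fun k => alpha k / k`!%:R * peval (q k) (\col_(j < l) peval (tnth rho j) x)) M =
    avg (fun k => series (fun m => alpha m / m`!%:R * dotp x (k *m xi) ^+ m) M).
  rewrite /series /= /avg average_sum //; apply: eq_bigr => m _.
  by rewrite qE averageZ.
rewrite /avg -averageB //; last exact: continuous_sumr.
apply: average_norm_le => // [|k Kk].
  by apply: continuous_subr => //; exact: continuous_sumr.
rewrite FE; apply: dominated_series_tail => // m.
rewrite /exp_coeff /= mulrAC normrM normfV normr_nat ler_wpM2r //.
rewrite normrM -(mul1r (T ^+ m)) ler_pM // normrX.
by apply: lerXn2r (dotp_orbit_le x Kk); rewrite nnegrE // (le_trans _ (dotp_orbit_le x Kk)).
Qed.

End SphericalAverages.

(** * Passage from real and imaginary parts to complex values *)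

Section ComplexParts.
Variable R : realType.
Local Open Scope complex_scope.

Lemma cvg_complex_pair (T : Type) (F : set_system T) (FF : Filter F) (f g : T -> R) (a b : R) :
  f @ F --> a -> g @ F --> b ->
  (fun t => f t +i* g t : R[i]^o) @ F --> (a +i* b : R[i]^o).
Proof.
move=> /cvgrPdist_le fa /cvgrPdist_le gb; apply/cvgrPdist_le => -[e e'].
(* A positive element of [R[i]] is real, so the tolerance has imaginary part 0. *)
rewrite ltcE /= => /andP[/eqP -> e0].
have e20 : 0 < e / 2 by rewrite divr_gt0.
apply: filterS2 (fa _ e20) (gb _ e20) => t ft gt.
rewrite normc_def /= lecR -(ler_sqr) ?nnegrE ?sqrtr_ge0 ?(ltW e0) //.
rewrite sqr_sqrtr ?addr_ge0 ?sqr_ge0 // -(real_normK (num_real (a - f t))).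
rewrite -(real_normK (num_real (b - g t))).
have h1 : `|a - f t| ^+ 2 <= (e / 2) ^+ 2 by apply: lerXn2r; rewrite ?nnegrE // ltW.
have h2 : `|b - g t| ^+ 2 <= (e / 2) ^+ 2 by apply: lerXn2r; rewrite ?nnegrE // ltW.
apply: le_trans (lerD h1 h2) _.
have -> : e ^+ 2 = (e / 2) ^+ 2 *+ 4.
  by rewrite {1}(splitr e) -mulr2n exprMn_n.
by rewrite -mulr2n ler_wpMn2l // sqr_ge0.
Qed.

Lemma partial_sum_complex (I : choiceType) (c1 c2 : I -> R) (p : I -> R) (A : {fset I}) :
  partial_sum (fun m => (c1 m +i* c2 m) * (p m)%:C) A =
  partial_sum (fun m => c1 m * p m) A +i* partial_sum (fun m => c2 m * p m) A.
Proof.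
rewrite /partial_sum; apply: (big_rec3 (fun x y z => z = x +i* y)) => //.
by move=> i x y z _ ->; apply/eqP; rewrite eq_complex /= !mulr0 subr0 add0r !eqxx.
Qed.

Lemma cexp_imaginary (t : R) : cexp ('i * t%:C) = cos t +i* sin t.
Proof.
apply/eqP; rewrite eq_complex /cexp /= !(mul0r, mulr0, mul1r, subr0, addr0, add0r, oppr0).
by rewrite expR0 !mul1r !eqxx.
Qed.

(** Puts the series in the shape expected by [average_entire]. *)
Lemma cos_coeff_series (t : R) : cos t =
  limn (series (fun k => (~~ odd k)%:R * (-1) ^+ k./2 / k`!%:R * t ^+ k)).
Proof.
rewrite unlock; congr (limn (series _)); apply/funext => k.
by rewrite /cos_coeff /= [RHS]mulrAC.
Qed.

Lemma sin_coeff_series (t : R) : sin t =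
  limn (series (fun k => (odd k)%:R * (-1) ^+ k.-1./2 / k`!%:R * t ^+ k)).
Proof.
rewrite unlock; congr (limn (series _)); apply/funext => k.
by rewrite /sin_coeff /= [RHS]mulrAC.
Qed.

Lemma sign_coeff_le1 (b : bool) k : `|b%:R * (-1) ^+ k : R| <= 1.
Proof. by rewrite normrM normrX normrN1 expr1n mulr1; case: b; rewrite ?normr1 ?normr0. Qed.

End ComplexParts.

Theorem proposition1p2 (R : realType) (n l : nat) (K : set 'M[R]_n)
    (K_subgroup : is_subgroup (@orthogonal_group R n) K) (K_compact : compact K)
    (mu : probability (borel_mx R n) R) (mu_haar : normalized_haar K mu)
    (rho : l.-tuple (mpoly.mpoly n R))
    (rho_gen : gen_algebra rho = invariant_polys K)
    (xi : 'cV[R]_n) :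
  exists h : 'cV[R]_l -> R[i],
    real_analytic h /\
    forall x : 'cV[R]_n,
      spherical K mu xi x = h (\col_(j < l) peval (tnth rho j) x).
Proof.
(* By Euler's formula the real and imaginary parts of [spherical] are averages of cosine and sine,
   each lifted separately. *)
have av := average_entire K_subgroup K_compact mu_haar rho_gen xi.
have [h1 [h1E h1a]] := av _ _ (@continuous_cos R)
  (fun k => sign_coeff_le1 R (~~ odd k) k./2) (@cos_coeff_series R).
have [h2 [h2E h2a]] := av _ _ (@continuous_sin R)
  (fun k => sign_coeff_le1 R (odd k) k.-1./2) (@sin_coeff_series R).
exists (fun y => Complex (h1 y) (h2 y)); split=> [a|x].
  have [c1 c1P] := h1a a; have [c2 c2P] := h2a a.
  (* Both expansions hold at every [y], so any neighbourhood of [a] serves. *)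
  exists (fun m => Complex (c1 m) (c2 m)); apply: nearW => y.
  rewrite (funext (partial_sum_complex c1 c2 _)).
  apply: cvg_complex_pair; [|exact: c1P|exact: c2P].
  by apply: filter_filter; exact: totally_filter.
rewrite -h1E -h2E /spherical /cintegral; congr Complex;
  by apply: eq_Rintegral => k _; rewrite cexp_imaginary.
Qed.
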